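(* Let $k\geqslant 1$ and let $R=\mathbb Z[x_1,x_2,\dots,x_k]$ or $R=\mathbb Z[x_1^{\pm 1},x_2^{\pm 1},\dots,x_k^{\pm 1}]$. Let $I$ be an ideal of $R$ generated by a finite set $F=\{f_1,f_2,\dots,f_s\}$. Then there exists a constant $C>0$, depending solely on $F$, such that the following holds: for every $g\in I$ and all $h_1,\dots,h_s\in R$ with $$g=h_1f_1+h_2f_2+\dots+h_sf_s\quad\text{and}\quad \operatorname{Area}_{I,F}(g)=\sum_{i=1}^s|h_i|,$$ one has $$\deg h_i\leqslant \deg g+C\operatorname{Area}_{I,F}(g)\quad\text{for all } i=1,\dots,s.$$
   Context: For $d=(d_1,\dots,d_k)\in\mathbb Z^k$ (in the Laurent polynomial case) or $d\in\mathbb Z_{\geqslant 0}^k$ (in the polynomial case), write $x^d=x_1^{d_1}\cdots x_k^{d_k}$ and $\|d\|=|d_1|+\dots+|d_k|$. An element $g\in R$ is written uniquely as $g=\sum_{i=1}^l\alpha_{d_i}x^{d_i}$ with distinct exponents $d_i$ and nonzero $\alpha_{d_i}\in\mathbb Z$. Its norm is $|g|=\sum_{i=1}^l|\alpha_{d_i}|$ and its degree is $\deg g=\max_i\|d_i\|$; by convention $|0|=0$ and $\deg 0=0$. For an ideal $I$ generated by $F=\{f_1,\dots,f_s\}$ and $g\in I$, the area of $g$ is $$\operatorname{Area}_{I,F}(g)=\min\Big\{\sum_{i=1}^s|h_i| \;\Big|\; g=h_1f_1+\dots+h_sf_s,\ h_i\in R\Big\}.$$ *)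

(* Defs.v *)
From HB Require Import structures.
From mathcomp Require Import all_boot all_algebra finmap.
From mathcomp Require Import boolp.
From mathcomp Require mpoly monalg.

Set Implicit Arguments.
Unset Strict Implicit.
Unset Printing Implicit Defensive.

Import GRing.Theory.
Local Open Scope fset_scope.
Local Open Scope ring_scope.

(* mpoly and monalg both declare msupp, mcoeff, g@_d and {mpoly R[n]}; each is
   imported only where its own versions are meant. *)
Section PolynomialNorm.
Import mpoly.
Variable k : nat.
Implicit Types g : {mpoly int[k]}.

Definition pnorm g : nat := (\sum_(d <- msupp g) `|g@_d|)%N.

(* An empty maximum is 0, so pdeg 0 = 0; likewise for ldeg. *)
Definition pdeg g : nat := (\max_(d <- msupp g) mdeg d)%N.

End PolynomialNorm.

Import monalg.

Definition lmonom (k : nat) := {ffun 'I_k -> int}.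

HB.instance Definition _ k := GRing.Zmodule.on (lmonom k).

(* The Laurent polynomial ring Z[x_1^{±1}, ..., x_k^{±1}], as the group ring of
   Z^k: finitely supported functions Z^k -> Z with the convolution product.
   The ring structure that monalg puts on {malg R[K]} is not available here,
   since a monomType has no invertible element besides its unit. *)
Definition laurent (k : nat) := {malg int[lmonom k]}.

HB.instance Definition _ k := GRing.Zmodule.on (laurent k).

Section LaurentRing.
Variable k : nat.
Implicit Types (g : laurent k) (d : lmonom k) (c : int).

Definition lone : laurent k := << 1 *g (0 : lmonom k)%R >>.

Definition lmul g1 g2 : laurent k :=
  \sum_(d1 <- msupp g1) \sum_(d2 <- msupp g2)
    << g1@_d1 * g2@_d2 *g (d1 + d2)%R >>.

Lemma lmulw (D1 D2 : {fset lmonom k}) g1 g2 :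
  msupp g1 `<=` D1 -> msupp g2 `<=` D2 ->
  lmul g1 g2 = \sum_(d1 <- D1) \sum_(d2 <- D2)
    << g1@_d1 * g2@_d2 *g (d1 + d2)%R >>.
Proof.
move=> le1 le2; rewrite /lmul (big_fset_incl _ le1) /=.
  apply/eq_bigr=> d1 _; apply/big_fset_incl => // d _ /mcoeff_outdom ->.
  by rewrite mulr0 monalgU0.
move=> d _ /mcoeff_outdom g1d.
by rewrite big1 => // d' _; rewrite g1d mul0r monalgU0.
Qed.

Lemma lmulUU c1 c2 d1 d2 :
  lmul << c1 *g d1 >> << c2 *g d2 >> = << c1 * c2 *g (d1 + d2)%R >>.
Proof.
by rewrite (lmulw msuppU_le msuppU_le) !big_seq_fset1 !mcoeffUU.
Qed.

Lemma lmulC : commutative lmul.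
Proof.
move=> g1 g2; rewrite /lmul exchange_big /=.
by apply/eq_bigr=> d1 _; apply/eq_bigr=> d2 _; rewrite mulrC addrC.
Qed.

Lemma lmulDl : left_distributive lmul +%R.
Proof.
move=> g1 g2 g.
rewrite (lmulw (msuppD_le g1 g2) (fsubset_refl _)).
rewrite (lmulw (fsubsetUl _ (msupp g2)) (fsubset_refl _)).
rewrite (lmulw (fsubsetUr (msupp g1) _) (fsubset_refl _)).
rewrite -big_split /=; apply/eq_bigr=> d1 _.
rewrite -big_split /=; apply/eq_bigr=> d2 _.
by rewrite mcoeffD mulrDl monalgUD.
Qed.

Lemma lmulDr : right_distributive lmul +%R.
Proof. by move=> g g1 g2; rewrite !(lmulC g) lmulDl. Qed.

Lemma lmul0g : left_zero 0 lmul.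
Proof. by move=> g; rewrite /lmul msupp0 big_seq_fset0. Qed.

Lemma lmulg0 : right_zero 0 lmul.
Proof. by move=> g; rewrite lmulC lmul0g. Qed.

Lemma lmul_suml (I : Type) (r : seq I) (F : I -> laurent k) g :
  lmul (\sum_(i <- r) F i) g = \sum_(i <- r) lmul (F i) g.
Proof. exact: (big_morph (lmul^~ g) (fun x y => lmulDl x y g) (lmul0g g)). Qed.

Lemma lmul_sumr (I : Type) (r : seq I) (F : I -> laurent k) g :
  lmul g (\sum_(i <- r) F i) = \sum_(i <- r) lmul g (F i).
Proof. exact: (big_morph (lmul g) (fun x y => lmulDr g x y) (lmulg0 g)). Qed.

Lemma lmulEl g1 g2 : lmul g1 g2 = \sum_(d <- msupp g1) lmul << g1@_d *g d >> g2.
Proof. by rewrite {1}(monalgE g1) lmul_suml. Qed.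

Lemma lmulEr g1 g2 : lmul g1 g2 = \sum_(d <- msupp g2) lmul g1 << g2@_d *g d >>.
Proof. by rewrite {1}(monalgE g2) lmul_sumr. Qed.

Lemma lmulA : associative lmul.
Proof.
move=> g1 g2 g3.
rewrite (lmulEl g1 (lmul g2 g3)) (lmulEl g1 g2) lmul_suml.
apply/eq_bigr=> d1 _; rewrite (lmulEl g2 g3) lmul_sumr (lmulEr _ g2) lmul_suml.
apply/eq_bigr=> d2 _; rewrite (lmulEr _ g3) lmul_sumr (lmulEr _ g3).
by apply/eq_bigr=> d3 _; rewrite !lmulUU mulrA addrA.
Qed.

Lemma lmul1g : left_id lone lmul.
Proof.
move=> g; rewrite [in LHS](monalgE g) lmul_sumr [RHS]monalgE.
by apply/eq_bigr=> d _; rewrite lmulUU mul1r add0r.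
Qed.

Lemma lone_neq0 : lone != 0.
Proof. by rewrite monalgU_eq0. Qed.

HB.instance Definition _ := GRing.Zmodule_isComNzRing.Build (laurent k)
  lmulA lmulC lmul1g lmulDl lone_neq0.

End LaurentRing.

Definition lweight k (d : lmonom k) : nat := (\sum_(i < k) `|d i|)%N.

Definition lnorm k (g : laurent k) : nat :=
  (\sum_(d <- msupp g) `|g@_d|)%N.

Definition ldeg k (g : laurent k) : nat :=
  (\max_(d <- msupp g) lweight d)%N.

Section Area.
Variables (R : comNzRingType) (norm : R -> nat) (s : nat) (f : 'I_s -> R).

Definition in_ideal (g : R) : Prop :=
  exists h : 'I_s -> R, g = \sum_(i < s) h i * f i.

Definition area_value (g : R) (n : nat) : Prop :=
  exists h : 'I_s -> R,
    g = \sum_(i < s) h i * f i /\ n = (\sum_(i < s) norm (h i))%N.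

Lemma area_value_ex (g : R) : in_ideal g -> exists n, `[< area_value g n >].
Proof.
by case=> h gE; exists (\sum_(i < s) norm (h i))%N; apply/asboolP; exists h.
Qed.

Definition area (g : R) (gI : in_ideal g) : nat := ex_minn (area_value_ex gI).

End Area.

(* Main.v *)
Require Import Defs.
From mathcomp Require Import all_boot all_algebra finmap.
From mathcomp Require Import zify.
From mathcomp Require monalg.
From mathcomp Require Import mpoly.

(** Let [D] bound the degrees of the generators.  Given an area-minimal
    representation of [g] and [T >= deg g], suppose that no [h_i] has a monomial
    of weight in [(T, T + 2D]].  Cut every [h_i] at weight [T]: the products of
    the low parts with the generators have weight at most [T + D], those of the
    high parts have weight more than [T + D], and [g] has no monomial of weight
    more than [T].  So the high parts contribute [0] to [g], and by minimality
    they vanish.  Hence, starting from [T = deg g], each of the successive layers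
    of thickness [2D] uses up at least one unit of the area until the [h_i] are
    exhausted. *)

Import GRing.Theory.
Local Open Scope ring_scope.

Section WeightedRing.

Variables (R : comNzRingType) (M : choiceType) (w : M -> nat).
Variables (coef : M -> R -> int) (supp : R -> seq M) (mono : int -> M -> R).

Hypothesis coefD : forall m, {morph coef m : g1 g2 / g1 + g2}.
Hypothesis coef_inj : forall g1 g2, coef^~ g1 =1 coef^~ g2 -> g1 = g2.
Hypothesis mem_supp : forall g m, (m \in supp g) = (coef m g != 0).
Hypothesis supp_uniq : forall g, uniq (supp g).
Hypothesis coef_mono : forall c d m, coef m (mono c d) = c *+ (d == m).
(* The two inequalities say that multiplying by a monomial of weight [w b] moves
   weights by at most [w b]; the second one replaces [w m = w a + w b], which
   fails for Laurent monomials. *)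
Hypothesis suppM : forall g1 g2 m, m \in supp (g1 * g2) ->
  exists a b, [/\ a \in supp g1, b \in supp g2,
    (w m <= w a + w b)%N & (w a <= w m + w b)%N].

Let norm g : nat := (\sum_(d <- supp g) `|coef d g|)%N.
Let deg g : nat := (\max_(d <- supp g) w d)%N.

Let coef0 m : coef m 0 = 0.
Proof. by apply: (addIr (coef m 0)); rewrite -coefD !add0r. Qed.

Let coef_sum m I (r : seq I) (P : pred I) (F : I -> R) :
  coef m (\sum_(i <- r | P i) F i) = \sum_(i <- r | P i) coef m (F i).
Proof. exact: (big_morph _ (coefD m) (coef0 m)). Qed.

Let coef_notin g m : m \notin supp g -> coef m g = 0.
Proof. by rewrite mem_supp negbK => /eqP. Qed.

Definition restr (P : pred M) (g : R) : R :=
  \sum_(d <- supp g | P d) mono (coef d g) d.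

Lemma coef_restr P g m : coef m (restr P g) = if P m then coef m g else 0.
Proof.
rewrite coef_sum big_mkcond /=.
have [gm|gm] := boolP (m \in supp g).
  rewrite (bigD1_seq m) //= big1 => [|d /negPf dm].
    by rewrite coef_mono eqxx mulr1n addr0.
  by rewrite coef_mono dm mulr0n if_same.
rewrite coef_notin // if_same big1_seq // => d /andP[_ gd].
case: ifP => // _; rewrite coef_mono; case: eqP => // dm.
by rewrite -dm gd in gm.
Qed.

Lemma supp_restr P g m : (m \in supp (restr P g)) = P m && (m \in supp g).
Proof. by rewrite !mem_supp coef_restr; case: (P m); rewrite // eqxx. Qed.

Lemma norm_restr P g :
  norm (restr P g) = (\sum_(d <- supp g | P d) `|coef d g|)%N.
Proof.
rewrite -big_filter /norm.
have eqs : perm_eq (supp (restr P g)) (filter P (supp g)).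
  apply: uniq_perm; rewrite ?filter_uniq // => m.
  by rewrite mem_filter supp_restr.
rewrite (perm_big _ eqs) !big_filter.
by apply: eq_bigr => d Pd; rewrite coef_restr Pd.
Qed.

Lemma restrC P g : restr P g + restr (predC P) g = g.
Proof.
apply: coef_inj => m; rewrite coefD !coef_restr /=.
by case: (P m); rewrite ?addr0 ?add0r.
Qed.

Lemma norm_restrC P g : norm g = (norm (restr P g) + norm (restr (predC P) g))%N.
Proof. by rewrite !norm_restr /norm (bigID P). Qed.

Section Representation.

Variables (s : nat) (f : 'I_s -> R) (D : nat).
Hypothesis fD : forall i, (deg (f i) <= D)%N.

Let w_f i m : m \in supp (f i) -> (w m <= D)%N.
Proof. by move=> fm; apply: leq_trans (fD i); apply: leq_bigmax_seq. Qed.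

Lemma supp_comb (h : 'I_s -> R) m : m \in supp (\sum_(i < s) h i * f i) ->
  exists i a, [/\ a \in supp (h i), (w m <= w a + D)%N & (w a <= w m + D)%N].
Proof.
rewrite mem_supp coef_sum => nz.
have [i hfm] : exists i, coef m (h i * f i) != 0.
  apply/existsP; apply: contraNT nz; rewrite negb_exists => /forallP z.
  by rewrite big1 // => i _; apply/eqP; move: (z i); rewrite negbK.
move: hfm; rewrite -mem_supp => /suppM[a [b [ha fb ma am]]].
exists i, a; move: (w_f i b fb); split=> //; lia.
Qed.

Lemma high_comb_eq0 (h : 'I_s -> R) g T :
  g = \sum_(i < s) h i * f i -> (deg g <= T)%N ->
  (forall i m, m \in supp (h i) -> (w m <= T)%N || (T + 2 * D < w m)%N) ->
  \sum_(i < s) restr (fun m => T < w m)%N (h i) * f i = 0.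
Proof.
move=> gE gT gap; set P : pred M := fun m => (T < w m)%N.
have gLH : g = \sum_(i < s) restr P (h i) * f i
             + \sum_(i < s) restr (predC P) (h i) * f i.
  by rewrite gE -big_split; apply: eq_bigr => i _ /=; rewrite -mulrDl restrC.
apply: coef_inj => m; rewrite coef0; apply/eqP; apply/negPn/negP.
rewrite -mem_supp => Hm; have [i [a []]] := supp_comb _ _ Hm.
rewrite supp_restr => /andP[Pa /gap]; rewrite /P in Pa => aT ma am.
have mT : (T + D < w m)%N by lia.
have gm : m \notin supp g.
  apply: contraL mT => gm; rewrite -leqNgt.
  by apply: leq_trans (leq_addr _ _); apply: leq_trans gT; apply: leq_bigmax_seq.
have Lm : m \notin supp (\sum_(i < s) restr (predC P) (h i) * f i).
  apply/negP => /supp_comb[j [b []]].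
  by rewrite supp_restr /= /P => /andP[bT _]; lia.
move: Hm; rewrite mem_supp; case/eqP.
by move: (coef_notin _ _ gm); rewrite gLH coefD (coef_notin _ _ Lm) addr0.
Qed.

Lemma deg_minimal_comb (h : 'I_s -> R) g :
  g = \sum_(i < s) h i * f i ->
  (forall h' : 'I_s -> R, g = \sum_(i < s) h' i * f i ->
     (\sum_(i < s) norm (h i) <= \sum_(i < s) norm (h' i))%N) ->
  forall i, (deg (h i) <= deg g + 2 * D * \sum_(i < s) norm (h i))%N.
Proof.
move=> gE hmin.
pose high T i := restr (fun m => T < w m)%N (h i).
pose N T := (\sum_(i < s) norm (high T i))%N.
have N_le T : (deg g <= T)%N -> (N (T + 2 * D) <= (N T).-1)%N.
  move=> gT; have [|NN] := ltnP (N (T + 2 * D)%N) (N T); first by lia.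
  have layers : N T = (N (T + 2 * D) + \sum_(i < s)
      \sum_(d <- supp (h i) | (T < w d)%N && (w d <= T + 2 * D)%N)
        `|coef d (h i)|)%N.
    rewrite /N -big_split; apply: eq_bigr => i _ /=.
    rewrite !norm_restr (bigID (fun d => T + 2 * D < w d)%N) /=.
    congr (_ + _)%N; apply: eq_bigl => d; lia.
  have gap i m : m \in supp (h i) -> (w m <= T)%N || (T + 2 * D < w m)%N.
    move=> hm; apply/negPn/negP; rewrite negb_or -!leqNgt -ltnNge => mT.
    have /eqP : (\sum_(i < s)
        \sum_(d <- supp (h i) | (T < w d)%N && (w d <= T + 2 * D)%N)
          `|coef d (h i)|)%N = 0%N by lia.
    rewrite sum_nat_eq0 => /forallP/(_ i).
    rewrite sum_nat_seq_eq0 => /allP/(_ m hm) /=.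
    by rewrite mT absz_eq0; move: hm; rewrite mem_supp => /negPf->.
  have high0 := high_comb_eq0 h g T gE gT gap.
  have := hmin (fun i => restr (predC (fun m => T < w m)%N) (h i)).
  have -> : (\sum_(i < s) norm (h i) = N T +
      \sum_(i < s) norm (restr (predC (fun m => T < w m)) (h i)))%N.
    by rewrite /N -big_split; apply: eq_bigr => i _; apply: norm_restrC.
  have NT_le : (N (T + 2 * D) <= N T)%N by lia.
  suff gL : g = \sum_(i < s) restr (predC (fun m => T < w m)%N) (h i) * f i.
    by move/(_ gL); lia.
  rewrite -[RHS]add0r -[X in X + _]high0 -big_split {1}gE.
  by apply: eq_bigr => i _ /=; rewrite -mulrDl restrC.
set A := (\sum_(i < s) norm (h i))%N.
have N_layer j : (N (deg g + 2 * D * j) <= A - j)%N.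
  elim: j => [|j IHj].
    rewrite subn0; apply: leq_sum => i _.
    by rewrite (norm_restrC (fun m => deg g + 2 * D * 0 < w m)%N (h i)) leq_addr.
  by have := N_le (deg g + 2 * D * j)%N (leq_addr _ _); rewrite mulnSr addnA; lia.
move=> i; apply/bigmax_leqP_seq => m hm _; rewrite leqNgt; apply/negP => mA.
have := N_layer A; rewrite subnn leqn0 sum_nat_eq0 => /forallP/(_ i).
rewrite norm_restr sum_nat_seq_eq0 => /allP/(_ m hm) /=.
by rewrite mA absz_eq0; move: hm; rewrite mem_supp => /negPf->.
Qed.

End Representation.

Lemma deg_le_area (s : nat) (f : 'I_s -> R) :
  exists2 C : nat, (0 < C)%N &
    forall (g : R) (gI : in_ideal f g) (h : 'I_s -> R),
      g = \sum_(i < s) h i * f i ->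
      area norm gI = (\sum_(i < s) norm (h i))%N ->
      forall i : 'I_s, (deg (h i) <= deg g + C * area norm gI)%N.
Proof.
pose D := (\max_(i < s) deg (f i))%N.
exists (2 * D).+1 => // g gI h gE hA i.
have fD j : (deg (f j) <= D)%N by apply: (leq_bigmax j).
have hmin h' : g = \sum_(i < s) h' i * f i ->
    (\sum_(i < s) norm (h i) <= \sum_(i < s) norm (h' i))%N.
  move=> gE'; rewrite -hA /area; case: ex_minnP => n _; apply.
  by apply/boolp.asboolP; exists h'.
by have := deg_minimal_comb _ _ _ fD h g gE hmin i; rewrite hA mulSn; lia.
Qed.

End WeightedRing.

Lemma lweightD k (a b : lmonom k) : (lweight (a + b)%R <= lweight a + lweight b)%N.
Proof.
rewrite -big_split; apply: leq_sum => i _ /=; rewrite ffunE.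
by have := leqD_dist (a i) 0 (- b i); rewrite opprK subr0 add0r.
Qed.

Lemma lweightN k (a : lmonom k) : lweight (- a) = lweight a.
Proof. by apply: eq_bigr => i _; rewrite ffunE abszN. Qed.

Lemma laurent_suppM k (g1 g2 : laurent k) m : m \in monalg.msupp (g1 * g2) ->
  exists a b, [/\ a \in monalg.msupp g1, b \in monalg.msupp g2 & m = a + b].
Proof.
rewrite -monalg.mcoeff_neq0 => nz.
have coefsum := big_morph _ (monalg.mcoeffD m) (@monalg.mcoeff0 _ int m).
have {nz} : has (fun a => has (fun b => m == a + b) (monalg.msupp g2))
              (monalg.msupp g1).
  apply: contraNT nz => /hasPn nab; rewrite [g1 * g2]/(lmul _ _) /lmul.
  rewrite coefsum big1_seq // => a /andP[_ /nab/hasPn nb].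
  rewrite coefsum big1_seq // => b /andP[_ /nb].
  by rewrite monalg.mcoeffU eq_sym => /negPf->.
by case/hasP=> a ga /hasP[b gb /eqP->]; exists a, b.
Qed.

Theorem theoremA (k : nat) (hk : (1 <= k)%N) :
  (forall (s : nat) (f : 'I_s -> {mpoly int[k]}),
     exists2 C : nat, (0 < C)%N &
       forall (g : {mpoly int[k]}) (gI : in_ideal f g)
              (h : 'I_s -> {mpoly int[k]}),
         g = \sum_(i < s) h i * f i ->
         area (@pnorm k) gI = (\sum_(i < s) pnorm (h i))%N ->
         forall i : 'I_s, (pdeg (h i) <= pdeg g + C * area (@pnorm k) gI)%N)
  /\
  (forall (s : nat) (f : 'I_s -> laurent k),
     exists2 C : nat, (0 < C)%N &
       forall (g : laurent k) (gI : in_ideal f g) (h : 'I_s -> laurent k),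
         g = \sum_(i < s) h i * f i ->
         area (@lnorm k) gI = (\sum_(i < s) lnorm (h i))%N ->
         forall i : 'I_s, (ldeg (h i) <= ldeg g + C * area (@lnorm k) gI)%N).
Proof.
split=> s f.
  apply: (@deg_le_area {mpoly int[k]} 'X_{1..k} (@mdeg k)
            (fun m g => g@_m) (@msupp k int) (fun c m => c *: 'X_[m])).
  - exact: mcoeffD.
  - by move=> g1 g2 /mpolyP.
  - by move=> g m; rewrite mcoeff_msupp.
  - exact: msupp_uniq.
  - by move=> c d m; rewrite mcoeffZ mcoeffX mulr_natr.
  - move=> g1 g2 m /msuppM_le/allpairsP[[a b] /= [ga gb ->]].
    by exists a, b; rewrite mdegD; split=> //; lia.
apply: (@deg_le_area (laurent k) (lmonom k) (@lweight k)
          (fun m g => monalg.mcoeff m g) (fun g => monalg.msupp g)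
          (fun c m => monalg.mkmalgU m c)).
- exact: monalg.mcoeffD.
- by move=> g1 g2 /monalg.malgP.
- by move=> g m; rewrite monalg.mcoeff_neq0.
- by move=> g; apply: fset_uniq.
- by move=> c d m; rewrite monalg.mcoeffU.
- move=> g1 g2 m /laurent_suppM[a [b [ga gb ->]]]; exists a, b; split=> //.
    exact: lweightD.
  by rewrite -{1}(addrK b a) -(lweightN _ b); apply: lweightD.
Qed.
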